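(* Let $R$ be a commutative unital ring, $I$ a finitely generated ideal of $R$, $M$ an $I$-reduced $R$-module and $N$ an injective $R$-module. Then $$\Lambda_I(\mathrm{Hom}_R(M,N))\cong \mathrm{Hom}_R(\Gamma_I(M),N)\quad\text{and}\quad \Lambda_I(D(M))\cong D(\Gamma_I(M)).$$
   Context: The $I$-torsion functor is $\Gamma_I(M):=\varinjlim_k \mathrm{Hom}_R(R/I^k, M)$ and the $I$-adic completion functor is $\Lambda_I(M):=\varprojlim_k M/I^kM$. For $a\in R$ let $f_a:M\to M$ be $m\mapsto am$ and $f_a^2=f_a\circ f_a$; $M$ is $I$-reduced if $\mathrm{Ker} f_a\cong \mathrm{Ker} f_a^2$ for every $a\in I$. $E$ denotes the direct product of the injective hulls $E_R(R/\mathfrak{m})$ of the $R$-modules $R/\mathfrak m$, where $\mathfrak m$ runs through the maximal ideals of $R$ (an injective cogenerator of $R\text{-Mod}$), and $D(-):=\mathrm{Hom}_R(-,E)$ is the general Matlis duality functor. *)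

(* Defs.v *)
From HB Require Import structures.
From mathcomp Require Import all_boot all_algebra.
From mathcomp Require Import boolp classical_sets.

Set Implicit Arguments.
Unset Strict Implicit.
Unset Printing Implicit Defensive.

Import GRing.Theory.
Local Open Scope ring_scope.
Local Open Scope quotient_scope.

Section Span.
Variables (R : pzRingType) (V : lmodType R).

Definition full_pred : V -> bool := fun=> true.

Lemma full_closed : GRing.subsemimod_closed full_pred.
Proof. by []. Qed.

HB.instance Definition _ := GRing.isSubmodClosed.Build R V full_pred full_closed.

Definition fullm : submodClosed V := GRing.SubmodClosed.clone R V full_pred _.

(* the submodule generated by A: the intersection of those containing A *)
Definition span_pred (A : set V) : V -> bool :=
  fun x => `[< forall S : submodClosed V, (forall y, A y -> y \in S) -> x \in S >].

Lemma span_closed A : GRing.subsemimod_closed (span_pred A).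
Proof.
split; first split.
- by apply/asboolP => S _; apply: rpred0.
- move=> x y /asboolP xA /asboolP yA; apply/asboolP => S AS.
  by apply: rpredD; [apply: xA | apply: yA].
- move=> a x /asboolP xA; apply/asboolP => S AS.
  by apply: rpredZ; apply: xA.
Qed.

HB.instance Definition _ A :=
  GRing.isSubmodClosed.Build R V (span_pred A) (span_closed A).

Definition spanm (A : set V) : submodClosed V :=
  GRing.SubmodClosed.clone R V (span_pred A) _.

Lemma mem_span (A : set V) x : A x -> x \in spanm A.
Proof. by move=> Ax; apply/asboolP => S; apply. Qed.

Lemma span_sub (A : set V) (S : submodClosed V) :
  (forall x, A x -> x \in S) -> {subset spanm A <= S}.
Proof. by move=> AS x /asboolP; apply. Qed.

End Span.

Section SubModuleType.
Variables (R : pzRingType) (V : lmodType R) (S : submodClosed V).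

Definition submod : Type := {x : V | x \in S}.

HB.instance Definition _ := [isSub of submod for @sval V (fun x => x \in S)].
HB.instance Definition _ := [Choice of submod by <:].
HB.instance Definition _ := [SubChoice_isSubLmodule of submod by <:].

End SubModuleType.

Section QuotientModule.
Variables (R : pzRingType) (V : lmodType R).

Section Scaling.
Variable S : submodClosed V.

Fact submodClosedN : oppr_closed S.
Proof. by move=> x Sx; rewrite -scaleN1r; apply: rpredZ. Qed.

(* submodClosed does not inherit from zmodClosed, which {quot _} requires *)
Definition zmod_of_submod : zmodClosed V :=
  HB.pack (GRing.SubmodClosed.sort S) (GRing.SubmodClosed.class S)
    (GRing.isOppClosed.Build V (GRing.SubmodClosed.sort S) submodClosedN).

Definition quotm : Type := Quotient.quot zmod_of_submod.

HB.instance Definition _ := EqQuotient.on quotm.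
HB.instance Definition _ := GRing.Zmodule.on quotm.

Definition piq (x : V) : quotm := \pi x.

Lemma eq_piq x y : piq x = piq y <-> x - y \in S.
Proof.
rewrite -[x - y \in S]/(x - y \in zmod_of_submod) Quotient.idealrBE.
by split=> /eqP.
Qed.

Lemma piq_surj (q : quotm) : exists x, q = piq x.
Proof. by exists (repr q); rewrite /piq reprK. Qed.

Lemma piqB : {morph piq : x y / x - y}.
Proof. by move=> x y; rewrite /piq !piE. Qed.

Lemma piqD : {morph piq : x y / x + y}.
Proof. by move=> x y; rewrite /piq !piE. Qed.

Definition scaleq (a : R) (q : quotm) : quotm := piq (a *: repr q).

Lemma scaleqE a x : scaleq a (piq x) = piq (a *: x).
Proof.
apply/eq_piq; rewrite -scalerBr; apply: rpredZ.
by apply/eq_piq; rewrite /piq reprK.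
Qed.

Fact scaleqA a b q : scaleq a (scaleq b q) = scaleq (a * b) q.
Proof. by case: (piq_surj q) => x ->; rewrite !scaleqE scalerA. Qed.

Fact scale1q : left_id 1 scaleq.
Proof. by move=> q; case: (piq_surj q) => x ->; rewrite scaleqE scale1r. Qed.

Fact scaleqDr : right_distributive scaleq +%R.
Proof.
move=> a q r; case: (piq_surj q) (piq_surj r) => x -> [y ->].
by rewrite -piqD !scaleqE scalerDr piqD.
Qed.

Fact scaleqDl q : {morph scaleq^~ q : a b / a + b}.
Proof.
by move=> a b; case: (piq_surj q) => x ->; rewrite !scaleqE scalerDl piqD.
Qed.

HB.instance Definition _ := GRing.Zmodule_isLmodule.Build R quotm
  scaleqA scale1q scaleqDr scaleqDl.

Fact piq_linear : linear piq.
Proof. by move=> a x y; rewrite piqD -scaleqE. Qed.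

HB.instance Definition _ := GRing.isLinear.Build R V quotm *:%R piq piq_linear.

End Scaling.

Section Projection.
Variables (S T : submodClosed V) (ST : {subset S <= T}).

(* the canonical projection V/S -> V/T for S contained in T *)
Definition quotm_proj_fun of {subset S <= T} :=
  fun q : quotm S => piq T (repr q).

Local Notation proj := (quotm_proj_fun ST).

Lemma quotm_projE x : proj (piq S x) = piq T x.
Proof. by apply/eq_piq/ST/eq_piq; rewrite /piq reprK. Qed.

Fact quotm_proj_linear : linear proj.
Proof.
move=> a q r; case: (piq_surj q) (piq_surj r) => x -> [y ->].
by rewrite -linearP !quotm_projE linearP.
Qed.

HB.instance Definition _ := GRing.isLinear.Build R (quotm S) (quotm T) *:%R
  proj quotm_proj_linear.

Definition quotm_proj : {linear quotm S -> quotm T} :=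
  GRing.Linear.clone _ _ _ _ proj _.

End Projection.
End QuotientModule.

Section Product.
Variables (R : pzRingType) (J : Type) (X : J -> lmodType R).

Definition prodm : Type := forall j, X j.

HB.instance Definition _ := gen_eqMixin prodm.
HB.instance Definition _ := gen_choiceMixin prodm.

Implicit Types x y z : prodm.

Definition addp x y : prodm := fun j => x j + y j.
Definition oppp x : prodm := fun j => - x j.
Definition zerop : prodm := fun=> 0.
Definition scalep (a : R) x : prodm := fun j => a *: x j.

Fact addpA : associative addp.
Proof. by move=> x y z; apply: functional_extensionality_dep => j; apply: addrA. Qed.
Fact addpC : commutative addp.
Proof. by move=> x y; apply: functional_extensionality_dep => j; apply: addrC. Qed.
Fact add0p : left_id zerop addp.
Proof. by move=> x; apply: functional_extensionality_dep => j; apply: add0r. Qed.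
Fact addNp : left_inverse zerop oppp addp.
Proof. by move=> x; apply: functional_extensionality_dep => j; apply: addNr. Qed.

HB.instance Definition _ := GRing.isZmodule.Build prodm addpA addpC add0p addNp.

Fact scalepA a b x : scalep a (scalep b x) = scalep (a * b) x.
Proof. by apply: functional_extensionality_dep => j; apply: scalerA. Qed.
Fact scale1p : left_id 1 scalep.
Proof. by move=> x; apply: functional_extensionality_dep => j; apply: scale1r. Qed.
Fact scalepDr : right_distributive scalep +%R.
Proof. by move=> a x y; apply: functional_extensionality_dep => j; apply: scalerDr. Qed.
Fact scalepDl x : {morph scalep^~ x : a b / a + b}.
Proof. by move=> a b; apply: functional_extensionality_dep => j; apply: scalerDl. Qed.

HB.instance Definition _ := GRing.Zmodule_isLmodule.Build R prodm
  scalepA scale1p scalepDr scalepDl.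

End Product.

Section Hom.
Variables (R : comPzRingType) (M N : lmodType R).

Definition homm : Type := {linear M -> N}.

HB.instance Definition _ := gen_eqMixin homm.
HB.instance Definition _ := gen_choiceMixin homm.

Lemma homP (f g : homm) : f =1 g -> f = g.
Proof.
case: f g => [f [[fA] [fZ]]] [g [[gA] [gZ]]] /= eq_fg.
have {}eq_fg : f = g by apply/funext.
by subst g; rewrite (Prop_irrelevance fA gA) (Prop_irrelevance fZ gZ).
Qed.

Implicit Types f g h : homm.

Definition addh f g : homm := GRing.Linear.clone _ _ _ _ (f \+ g) _.
Definition opph f : homm := GRing.Linear.clone _ _ _ _ (\- f) _.
Definition zeroh : homm := GRing.Linear.clone R M N _ \0 _.
Definition scaleh (a : R) f : homm := GRing.Linear.clone _ _ _ _ (a \*: f) _.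

Fact addhA : associative addh.
Proof. by move=> f g h; apply: homP => x; apply: addrA. Qed.
Fact addhC : commutative addh.
Proof. by move=> f g; apply: homP => x; apply: addrC. Qed.
Fact add0h : left_id zeroh addh.
Proof. by move=> f; apply: homP => x; apply: add0r. Qed.
Fact addNh : left_inverse zeroh opph addh.
Proof. by move=> f; apply: homP => x; apply: addNr. Qed.

HB.instance Definition _ := GRing.isZmodule.Build homm addhA addhC add0h addNh.

Fact scalehA a b f : scaleh a (scaleh b f) = scaleh (a * b) f.
Proof. by apply: homP => x; apply: scalerA. Qed.
Fact scale1h : left_id 1 scaleh.
Proof. by move=> f; apply: homP => x; apply: scale1r. Qed.
Fact scalehDr : right_distributive scaleh +%R.
Proof. by move=> a f g; apply: homP => x; apply: scalerDr. Qed.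
Fact scalehDl f : {morph scaleh^~ f : a b / a + b}.
Proof. by move=> a b; apply: homP => x; apply: scalerDl. Qed.

HB.instance Definition _ := GRing.Zmodule_isLmodule.Build R homm
  scalehA scale1h scalehDr scalehDl.

End Hom.

Section Kernel.
Variables (R : pzRingType) (M N : lmodType R) (f : {linear M -> N}).

Definition ker_pred : M -> bool := fun x => f x == 0.

Fact ker_closed : GRing.subsemimod_closed ker_pred.
Proof.
split; first split.
- by rewrite unfold_in linear0.
- by move=> x y; rewrite !unfold_in linearD => /eqP -> /eqP ->; rewrite addr0.
- by move=> a x; rewrite !unfold_in linearZ /= => /eqP ->; rewrite scaler0.
Qed.

HB.instance Definition _ := GRing.isSubmodClosed.Build R M ker_pred ker_closed.

Definition kerm : submodClosed M := GRing.SubmodClosed.clone R M ker_pred _.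

End Kernel.

Definition isomorphic (R : pzRingType) (M N : lmodType R) : Prop :=
  exists f : {linear M -> N}, bijective f.

Section InverseLimit.
Variables (R : pzRingType) (X : nat -> lmodType R).
Variable p : forall i j, (i <= j)%N -> {linear X j -> X i}.

Definition compatible_pred : prodm X -> bool :=
  fun x => `[< forall i j (le_ij : (i <= j)%N), p le_ij (x j) = x i >].

Fact compatible_closed : GRing.subsemimod_closed compatible_pred.
Proof.
split; first split.
- by apply/asboolP => i j le_ij; apply: linear0.
- move=> x y /asboolP px /asboolP py; apply/asboolP => i j le_ij.
  by rewrite linearD px py.
- move=> a x /asboolP px; apply/asboolP => i j le_ij.
  by rewrite linearZ /= px.
Qed.

HB.instance Definition _ :=
  GRing.isSubmodClosed.Build R (prodm X) compatible_pred compatible_closed.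

Definition compatible : submodClosed (prodm X) :=
  GRing.SubmodClosed.clone R (prodm X) compatible_pred _.

Definition invlim : lmodType R := submod compatible.

End InverseLimit.

Section DirectLimit.
Variables (R : pzRingType) (X : nat -> lmodType R).

Definition finsupp_pred : prodm X -> bool :=
  fun x => `[< exists n, forall k, (n <= k)%N -> x k = 0 >].

Fact finsupp_closed : GRing.subsemimod_closed finsupp_pred.
Proof.
split; first split.
- by apply/asboolP; exists 0%N.
- move=> x y /asboolP[m xm] /asboolP[n yn]; apply/asboolP.
  exists (maxn m n) => k; rewrite geq_max => /andP[mk nk].
  by rewrite -[LHS]/(x k + y k) xm // yn // addr0.
- move=> a x /asboolP[m xm]; apply/asboolP; exists m => k mk.
  by rewrite -[LHS]/(a *: x k) xm // scaler0.
Qed.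

HB.instance Definition _ :=
  GRing.isSubmodClosed.Build R (prodm X) finsupp_pred finsupp_closed.

Definition finsupp : submodClosed (prodm X) :=
  GRing.SubmodClosed.clone R (prodm X) finsupp_pred _.

Definition dsum : lmodType R := submod finsupp.

Fact dfwith_finsupp k (x : X k) :
  (dfwith (0 : prodm X) x : prodm X) \in finsupp.
Proof.
apply/asboolP; exists k.+1 => j kj; rewrite dfwith_out //.
by rewrite neq_ltn kj.
Qed.

Definition dsum_in k (x : X k) : dsum :=
  exist (fun y => y \in finsupp) _ (dfwith_finsupp x).

Variable t : forall i j, (i <= j)%N -> {linear X i -> X j}.

(* quotient of the direct sum identifying every x with its images *)
Definition dirlim : lmodType R :=
  quotm (spanm [set z : dsum | exists i j (le_ij : (i <= j)%N) (x : X i),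
    z = dsum_in x - dsum_in (t le_ij x)]%classic).

End DirectLimit.

Notation ideal R := (submodClosed R^o).

Section Ideals.
Variable R : comPzRingType.
Implicit Types (I J : ideal R) (M : lmodType R).

Definition fin_gen I : Prop :=
  exists s : seq R^o, I =i spanm [set x | x \in s]%classic.

Definition smul I M (N : submodClosed M) : submodClosed M :=
  spanm [set y | exists a x, [/\ a \in I, x \in N & y = (a : R) *: x]]%classic.

Definition ideal_exp I (k : nat) : ideal R := iter k (@smul I R^o) (fullm R^o).

Definition ideal_exp_mul I k M : submodClosed M := smul (ideal_exp I k) (fullm M).

Lemma smulS I J M (N P : submodClosed M) :
  {subset I <= J} -> {subset N <= P} -> {subset smul I N <= smul J P}.
Proof.
move=> IJ NP; apply: span_sub => _ [a [x [aI xN ->]]].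
by apply: mem_span; exists a, x; split; [apply: IJ | apply: NP |].
Qed.

Lemma ideal_expS I i j : (i <= j)%N -> {subset ideal_exp I j <= ideal_exp I i}.
Proof.
elim: i j => [|i IHi] [|j] // le_ij; apply: smulS => //; exact: IHi.
Qed.

Lemma ideal_exp_mulS I M i j :
  (i <= j)%N -> {subset ideal_exp_mul I j M <= ideal_exp_mul I i M}.
Proof. by move=> le_ij; apply: smulS => //; apply: ideal_expS. Qed.

Definition maximal_ideal I : Prop :=
  1 \notin I /\
  forall J, {subset I <= J} -> 1 \notin J -> {subset J <= I}.

Record max_ideal := MaxIdeal {
  max_ideal_val :> ideal R;
  max_idealP : maximal_ideal max_ideal_val
}.

End Ideals.

Section TorsionCompletion.
Variables (R : comPzRingType) (I : ideal R).

Section Precomposition.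
Variables (M N P : lmodType R) (u : {linear M -> N}).

Definition precomp_fun (f : homm N P) : homm M P :=
  GRing.Linear.clone _ _ _ _ (f \o u) _.

Fact precomp_linear : linear precomp_fun.
Proof. by move=> a f g; apply: homP. Qed.

HB.instance Definition _ :=
  GRing.isLinear.Build R (homm N P) (homm M P) *:%R precomp_fun precomp_linear.

Definition precomp : {linear homm N P -> homm M P} :=
  GRing.Linear.clone _ _ _ _ precomp_fun _.

End Precomposition.

Variable M : lmodType R.

(* Gamma_I(M), the colimit of Hom(R/I^k, M) *)
Definition torsion : lmodType R :=
  @dirlim R (fun k => homm (quotm (ideal_exp I k)) M)
    (fun i j le_ij => precomp M (quotm_proj (ideal_expS (I := I) le_ij))).

(* Lambda_I(M), the limit of M/I^k M *)
Definition completion : lmodType R :=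
  @invlim R (fun k => quotm (ideal_exp_mul I k M))
    (fun i j le_ij => quotm_proj (@ideal_exp_mulS R I M i j le_ij)).

Definition homothety (a : R) : {linear M -> M} :=
  GRing.Linear.clone _ _ _ _ (a \*: @idfun M) _.

Definition reduced : Prop := forall a : R, a \in I ->
  isomorphic (submod (kerm (homothety a)))
             (submod (kerm (homothety a \o homothety a))).

End TorsionCompletion.

Section Injective.
Variable R : pzRingType.

Definition injective_module (N : lmodType R) : Prop :=
  forall (A B : lmodType R) (i : {linear A -> B}) (f : {linear A -> N}),
    injective i -> exists g : {linear B -> N}, g \o i =1 f.

(* i is an essential embedding of A into the injective module Q *)
Definition injective_hull (A Q : lmodType R) (i : {linear A -> Q}) : Prop :=
  [/\ injective_module Q, injective i
    & forall S : submodClosed Q, (exists2 y, y \in S & y != 0) ->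
      exists2 x, i x \in S & i x != 0].

End Injective.

(* D(M) = Hom(M, E), where E is the product of the given hulls E_R(R/m) *)
Definition matlis_dual (R : comPzRingType) (Ehull : max_ideal R -> lmodType R)
  (M : lmodType R) : lmodType R := homm M (prodm Ehull).

(* Main.v *)
Require Import Defs.
From HB Require Import structures.
From mathcomp Require Import all_boot ssralg.
From mathcomp Require Import boolp classical_sets.

(** Both sides are computed by T = (0 :_M I), the submodule of the elements of M
    killed by I.

    Torsion.  An abstract isomorphism between Ker a and Ker a^2 forces a to
    annihilate Ker a^2, so reducedness says that a^2 x = 0 implies a x = 0 for
    a in I.  Hence an element killed by some power I^k is already killed by I.
    A morphism R/I^k -> M is the choice of an element killed by I^k, namely the
    image of 1, and evaluation at 1 identifies Gamma_I(M) with T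
    ([torsion_reduced]).

    Completion.  Put H = Hom(M, N).  For every k >= 1, I^k H consists of the
    morphisms vanishing on T ([homm_exp_mulP]).  One inclusion is clear.  For
    the other, let a_1, ..., a_n generate I.  The common kernel of the
    multiplications by the a_i^k is T, by reducedness, so a morphism f vanishing
    on T factors through (a_1^k, ..., a_n^k) : M -> M^n; as N is injective,
    f = a_1^k g_1 + ... + a_n^k g_n for some g_i in H.  The system H / I^k H is
    therefore constant from k = 1 on, and Lambda_I(H) = H / I H = Hom(T, N), the
    restriction H -> Hom(T, N) being onto because N is injective
    ([completion_homm]).

    The Matlis dual is the case where N is a product of injective hulls, which
    is injective. *)

Set Implicit Arguments.
Unset Strict Implicit.
Unset Printing Implicit Defensive.

Import GRing.Theory.
Local Open Scope ring_scope.

(** * Morphisms and isomorphisms of modules *)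

Lemma linear_exists (R : pzRingType) (A B : lmodType R) (f : A -> B) :
  linear f -> exists g : {linear A -> B}, g =1 f.
Proof.
move=> f_lin.
pose m := GRing.isLinear.Build R A B *:%R f f_lin.
pose g : {linear A -> B} := HB.pack f m.
by exists g.
Qed.

Lemma linear_inv (R : pzRingType) (A B : lmodType R) (f : {linear A -> B}) :
  bijective f -> exists g : {linear B -> A}, cancel f g /\ cancel g f.
Proof.
move=> [g fK gK].
have [h hE] : exists h : {linear B -> A}, h =1 g.
  apply: linear_exists => a x y.
  by rewrite -{1}(gK x) -{1}(gK y) -linearP fK.
by exists h; split=> x; rewrite hE.
Qed.

Lemma isomorphic_sym (R : pzRingType) (A B : lmodType R) :
  isomorphic A B -> isomorphic B A.
Proof. by move=> [f /linear_inv[g [fK gK]]]; exists g; exists f. Qed.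

Lemma isomorphic_trans (R : pzRingType) (A B C : lmodType R) :
  isomorphic A B -> isomorphic B C -> isomorphic A C.
Proof.
move=> [f f_bij] [g g_bij].
by exists (GRing.Linear.clone _ _ _ _ (g \o f) _); apply: bij_comp.
Qed.

(** Both targets are A modulo the common kernel.  Every isomorphism below between
    a limit or a colimit and a concrete module is obtained in this way. *)
Lemma isomorphic_coimages (R : pzRingType) (A B C : lmodType R)
    (u : {linear A -> B}) (v : {linear A -> C}) :
  (forall b, exists x, u x = b) -> (forall c, exists x, v x = c) ->
  (forall x, u x = 0 <-> v x = 0) -> isomorphic B C.
Proof.
move=> u_surj v_surj ker_uv.
have eq_uv x y : u x = u y <-> v x = v y.
  split=> /eqP; rewrite -subr_eq0 -linearB => /eqP /ker_uv /eqP;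
  by rewrite linearB subr_eq0 => /eqP.
pose s b := sval (cid (u_surj b)); pose t c := sval (cid (v_surj c)).
have sK b : u (s b) = b by rewrite /s; case: cid.
have tK c : v (t c) = c by rewrite /t; case: cid.
have [h hE] : exists h : {linear B -> C}, h =1 v \o s.
  apply: linear_exists => a x y /=.
  by rewrite -linearP; apply/eq_uv; rewrite linearP !sK.
exists h; exists (u \o t) => [b | c]; rewrite hE /=.
  by rewrite -[RHS]sK; apply/eq_uv; rewrite tK.
by rewrite -[RHS]tK; apply/eq_uv; rewrite sK.
Qed.

Lemma isomorphic_homm (R : comPzRingType) (A B N : lmodType R) :
  isomorphic A B -> isomorphic (homm A N) (homm B N).
Proof.
move=> [f /linear_inv[g [fK gK]]].
by exists (precomp N g); exists (precomp N f) => u; apply: homP => x /=;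
  rewrite ?fK ?gK.
Qed.

(** * Injective modules *)

(** Injectivity of N applied to the embedding of A / Ker i into B. *)
Lemma injective_extend (R : pzRingType) (N A B : lmodType R)
    (i : {linear A -> B}) (f : {linear A -> N}) :
  injective_module N -> (forall x, i x = 0 -> f x = 0) ->
  exists g : {linear B -> N}, g \o i =1 f.
Proof.
move=> N_inj ker_if.
have kerE x y : (piq (kerm i) x = piq (kerm i) y) <-> i x = i y.
  rewrite eq_piq unfold_in /= /ker_pred linearB subr_eq0.
  by split=> /eqP.
have reprE x : i (repr (piq (kerm i) x)) = i x.
  by apply/kerE; rewrite /piq reprK.
have freprE x : f (repr (piq (kerm i) x)) = f x.
  apply/eqP; rewrite -subr_eq0 -linearB; apply/eqP/ker_if.
  by rewrite linearB reprE subrr.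
have [j jE] : exists j : {linear quotm (kerm i) -> B}, j =1 i \o repr.
  apply: linear_exists => a q r; case: (piq_surj q) (piq_surj r) => x -> [y ->].
  by rewrite -linearP /= !reprE linearP.
have [h hE] : exists h : {linear quotm (kerm i) -> N}, h =1 f \o repr.
  apply: linear_exists => a q r; case: (piq_surj q) (piq_surj r) => x -> [y ->].
  by rewrite -linearP /= !freprE linearP.
have j_inj : injective j.
  move=> q r; case: (piq_surj q) (piq_surj r) => x -> [y ->].
  by rewrite !jE /= !reprE => /kerE.
have [g gE] := N_inj _ _ j h j_inj.
exists g => x; have := gE (piq (kerm i) x).
by rewrite /= jE hE /= reprE freprE.
Qed.

Lemma injective_prodm (R : pzRingType) (J : Type) (X : J -> lmodType R) :
  (forall j, injective_module (X j)) -> injective_module (prodm X).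
Proof.
move=> X_inj A B i f i_inj.
have ext j : exists g : {linear B -> X j}, forall x, g (i x) = f x j.
  have [fj fjE] : exists fj : {linear A -> X j}, fj =1 (fun x => f x j).
    by apply: linear_exists => a x y; rewrite linearP.
  have [g gE] := X_inj j _ _ i fj i_inj.
  by exists g => x; rewrite -fjE -gE.
pose g j := sval (cid (ext j)).
have gE j x : g j (i x) = f x j by rewrite /g; case: cid.
have [h hE] : exists h : {linear B -> prodm X}, h =1 (fun y j => g j y).
  apply: linear_exists => a x y; apply: functional_extensionality_dep => j.
  by rewrite linearP.
exists h => x; rewrite /= hE; apply: functional_extensionality_dep => j.
exact: gE.
Qed.

(** * Elements killed by a set of scalars *)

Section Annihilated.
Variables (R : comPzRingType) (M : lmodType R).
Implicit Type P : set R.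

Definition annm_pred P : M -> bool :=
  fun x => `[< forall a, P a -> a *: x = 0 >].

Fact annm_closed P : GRing.subsemimod_closed (annm_pred P).
Proof.
split; first split.
- by apply/asboolP => a _; rewrite scaler0.
- move=> x y /asboolP Px /asboolP Py; apply/asboolP => a Pa.
  by rewrite scalerDr Px // Py // addr0.
- move=> b x /asboolP Px; apply/asboolP => a Pa.
  by rewrite scalerA mulrC -scalerA Px // scaler0.
Qed.

HB.instance Definition _ P :=
  GRing.isSubmodClosed.Build R M (annm_pred P) (annm_closed P).

Definition annm P : submodClosed M :=
  GRing.SubmodClosed.clone R M (annm_pred P) _.

Lemma annmP P x : reflect (forall a, P a -> a *: x = 0) (x \in annm P).
Proof. exact: asboolP. Qed.

End Annihilated.

Definition idealset (R : comPzRingType) (I : ideal R) : set R :=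
  [set a : R | a \in I]%classic.

Lemma ideal_expn (R : comPzRingType) (I : ideal R) (a : R) k :
  a \in I -> a ^+ k \in ideal_exp I k.
Proof.
move=> aI; elim: k => [|k IHk] //.
by apply: mem_span; exists a, (a ^+ k); split; rewrite // exprS.
Qed.

Lemma ideal_exp1_sub (R : comPzRingType) (I : ideal R) k :
  {subset ideal_exp I k.+1 <= I}.
Proof.
apply: span_sub => _ [a [b [aI _ ->]]].
rewrite -[a *: b]/(a * (b : R)) mulrC; exact: (@rpredZ _ R^o I b a).
Qed.

(** * Reduced modules *)

Section Reduced.
Variables (R : comPzRingType) (I : ideal R) (M : lmodType R).
Hypothesis M_reduced : reduced I M.

(** Only the linearity of the isomorphism matters: a annihilates Ker a, hence
    also the isomorphic module Ker a^2. *)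
Lemma reduced_sq (a : R) (x : M) : a \in I -> a *: (a *: x) = 0 -> a *: x = 0.
Proof.
move=> aI aax.
have [f [g _ gK]] := M_reduced aI.
have xker : x \in kerm (homothety M a \o homothety M a).
  by rewrite unfold_in /= /ker_pred /= aax.
pose x' : submod (kerm (homothety M a \o homothety M a)) := exist _ x xker.
have agx : a *: g x' = 0.
  apply: val_inj; rewrite linearZ /=; apply/eqP; exact: (valP (g x')).
have ax' : a *: x' = 0 by rewrite -[x']gK -linearZ agx linear0.
exact: (congr1 val ax').
Qed.

Lemma reduced_exp (a : R) (x : M) k : a \in I -> a ^+ k.+1 *: x = 0 -> a *: x = 0.
Proof.
move=> aI; elim: k => [|k IHk] // akx; apply: IHk.
rewrite exprS -scalerA; apply: reduced_sq => //.
by rewrite !scalerA -mulrA -!exprS.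
Qed.

Lemma reduced_ideal_exp k :
  {subset annm M (idealset (ideal_exp I k)) <= annm M (idealset I)}.
Proof.
move=> x /annmP xk; apply/annmP => a aI.
apply: (@reduced_exp a x k) => //.
by rewrite exprS -scalerA xk ?scaler0 //; apply: ideal_expn.
Qed.

End Reduced.

(** * Completion of Hom(M, N) *)

Section Completion.
Variables (R : comPzRingType) (I : ideal R) (M N : lmodType R).
Hypotheses (I_fin_gen : fin_gen I) (M_reduced : reduced I M).
Hypothesis N_injective : injective_module N.

Local Notation T := (annm M (idealset I)).

(** The map M -> M^n given by the powers a^k, for a in s, is handled one generator
    at a time: if S is the common kernel of the other powers, f restricted to S
    vanishes on the kernel of a^k, hence equals a^k g on S for some g : M -> N.
    Then f - a^k g vanishes on S, while a^k g lies in I^k Hom(M, N). *)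
Lemma homm_mem_exp_mul k (s : seq R) (f : homm M N) :
  {in s, forall a, a \in I} ->
  {in annm M [set a ^+ k | a in [set a | a \in s]]%classic, f =1 \0} ->
  f \in ideal_exp_mul I k (homm M N).
Proof.
elim: s f => [|a s IHs] f sI f0.
  have -> : f = 0 by apply: homP => x; apply: f0; apply/annmP => c [b].
  exact: rpred0.
set S := annm M [set b ^+ k | b in [set b | b \in s]]%classic.
pose i : {linear submod S -> M} :=
  GRing.Linear.clone _ _ _ _ (homothety M (a ^+ k) \o val) _.
pose fS : {linear submod S -> N} := GRing.Linear.clone _ _ _ _ (f \o val) _.
have [|g gE] := injective_extend (i := i) (f := fS) N_injective.
  move=> x ax0; apply: f0; apply/annmP => _ [b bs <-].
  move: bs; rewrite /= inE => /orP[/eqP-> // | bs].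
  by apply: (elimT (annmP _ _) (valP x)); exists b.
rewrite -[f](subrK ((a ^+ k) *: (g : homm M N))); apply: rpredD.
  apply: IHs => [b bs | x xS]; first by apply: sI; rewrite inE bs orbT.
  have /= := gE (exist _ x xS : submod S); rewrite linearZ /= => ge.
  by rewrite -[LHS]/(f x - a ^+ k *: g x) ge subrr.
apply: mem_span; exists (a ^+ k), (g : homm M N); split=> //.
by apply: ideal_expn; apply: sI; rewrite inE eqxx.
Qed.

(** The right-hand side does not mention k: this is why the tower
    Hom(M, N) / I^k Hom(M, N) is constant for k >= 1. *)
Lemma homm_exp_mulP k (f : homm M N) :
  f \in ideal_exp_mul I k.+1 (homm M N) <-> {in T, f =1 \0}.
Proof.
split=> [fI x xT | f0].
  pose ev : homm M N -> N := fun g => g x.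
  (* x is killed by I, so I^(k+1) Hom(M, N) dies under evaluation at x *)
  have [evl evE] : exists e : {linear homm M N -> N}, e =1 ev.
    by apply: linear_exists.
  have : f \in kerm evl.
    move: f fI; apply: span_sub => _ [a [g [aI _ ->]]].
    rewrite unfold_in /= /ker_pred evE /ev -[_ x]/(a *: g x) -linearZ.
    by rewrite (elimT (annmP _ _) xT) ?linear0 //; apply: ideal_exp1_sub aI.
  by rewrite unfold_in /= /ker_pred evE => /eqP.
have [s sI] := I_fin_gen.
have s_sub : {in s, forall a, a \in I}.
  by move=> a a_s; rewrite sI; apply: mem_span.
apply: (@homm_mem_exp_mul k.+1 s) => // x /annmP xs; apply: f0.
(* the scalars killing x form an ideal, so it suffices to kill x by each
   generator a, and a^(k+1) x = 0 gives a x = 0 *)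
have s_ann : {subset I <= [pred a : R | a *: x == 0]}.
  pose rx : R^o -> M := fun a => (a : R) *: x.
  have [rl rE] : exists e : {linear R^o -> M}, e =1 rx.
    by apply: linear_exists => a b c; rewrite /rx scalerDl scalerA.
  move=> a; rewrite sI => as_; rewrite inE -[_ *: x]/(rx a) -rE.
  move: a as_; apply: (@span_sub _ _ _ (kerm rl)) => a a_s.
  rewrite unfold_in /= /ker_pred rE /rx; apply/eqP.
  by apply: (reduced_exp M_reduced (k := k)); [apply: s_sub | apply: xs; exists a].
by apply/annmP => a /s_ann /eqP.
Qed.

Lemma completion_homm :
  isomorphic (completion I (homm M N)) (homm (submod T) N).
Proof.
pose H := homm M N.
pose C :=
  compatible (fun i j le_ij => quotm_proj (@ideal_exp_mulS R I H i j le_ij)).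
have constP (f : H) : (fun k => piq (ideal_exp_mul I k H) f) \in C.
  by apply/asboolP => i j le_ij; apply: quotm_projE.
(* u sends f to the constant family of its classes *)
have [u uE] : exists u : {linear H -> completion I H},
    forall f k, val (u f) k = piq (ideal_exp_mul I k H) f.
  have [|u uE] := @linear_exists _ H (completion I H)
    (fun f => exist (fun y => y \in C) _ (constP f)).
    move=> a f g; apply: val_inj; apply: functional_extensionality_dep => k /=.
    exact: linearP.
  by exists u => f k; rewrite uE.
pose incl : {linear submod T -> M} := GRing.Linear.clone _ _ _ _ val _.
apply: (@isomorphic_coimages _ _ _ _ u (precomp N incl)).
(* a compatible family is determined by its component of index 1; the component
   of index 0 lives in H / H *)
- move=> c; have /asboolP c_comp := valP c.
  have [f fE] := piq_surj (val c 1%N).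
  exists f; apply: val_inj; apply: functional_extensionality_dep => k.
  rewrite uE; case: k => [|k]; first by rewrite -(c_comp 0%N 1%N isT) fE /= quotm_projE.
  have [g gE] := piq_surj (val c k.+1); rewrite gE; apply/eq_piq.
  have := c_comp 1%N k.+1 isT; rewrite gE fE /= quotm_projE => /esym /eq_piq.
  by move=> /(homm_exp_mulP 0) fg; apply/homm_exp_mulP.
- move=> h; have [|g gE] := injective_extend (i := incl) (f := h) N_injective.
    by move=> x x0; have -> : x = 0 by [apply: val_inj]; rewrite linear0.
  by exists g; apply: homP.
move=> f; split=> [uf0 | vf0].
  apply: homP => x /=.
  have : piq (ideal_exp_mul I 1 H) f = piq _ 0 by rewrite -uE uf0 [RHS]linear0.
  by move=> /eq_piq; rewrite subr0 => /(homm_exp_mulP 0) f0; apply/f0/valP.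
have fT : {in T, f =1 \0}.
  move=> x xT.
  exact: (congr1 (fun g : homm (submod T) N => g (exist _ x xT)) vf0).
apply: val_inj; apply: functional_extensionality_dep => k; rewrite uE.
rewrite -[RHS](linear0 (piq (ideal_exp_mul I k H))); apply/eq_piq; rewrite subr0.
by apply: (ideal_exp_mulS (leqnSn k)); apply/homm_exp_mulP.
Qed.

End Completion.

(** * Direct sums *)

Section DirectSum.
Variables (R : pzRingType) (X : nat -> lmodType R).

Lemma dsum_in_linear k : linear (@dsum_in R X k).
Proof.
move=> a x y; apply: val_inj; apply: functional_extensionality_dep => j /=.
rewrite -[RHS]/(a *: dfwith (0 : prodm X) x j + dfwith (0 : prodm X) y j).
have [<-|kj] := eqVneq k j; first by rewrite !dfwith_in.
by rewrite !dfwith_out // scaler0 addr0.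
Qed.

HB.instance Definition _ k :=
  GRing.isLinear.Build R (X k) (dsum X) *:%R (@dsum_in R X k) (@dsum_in_linear k).

Lemma dsum_ind (P : dsum X -> Prop) :
  P 0 -> (forall x y, P x -> P y -> P (x + y)) ->
  (forall k (x : X k), P (dsum_in x)) -> forall z, P z.
Proof.
move=> P0 PD Pin z; have /asboolP[n] := valP z.
elim: n z => [|n IHn] z zn.
  suff -> : z = 0 by [].
  by apply: val_inj; apply: functional_extensionality_dep => k; apply: zn.
rewrite -[z](subrK (dsum_in (val z n))); apply: PD => //; apply: IHn => k nk.
rewrite -[LHS]/(val z k - dfwith (0 : prodm X) (val z n) k).
move: nk; rewrite leq_eqVlt => /orP[/eqP <-|nk]; first by rewrite dfwith_in subrr.
by rewrite zn // dfwith_out ?subr0 // neq_ltn nk.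
Qed.

(** The universal property of the direct sum.  The map is z |-> sum of the
    e_k (z_k) over k < n, for any n beyond the support of z; linearity follows by
    taking n beyond the supports of both arguments. *)
Lemma dsum_desc (M : lmodType R) (e : forall k, {linear X k -> M}) :
  exists w : {linear dsum X -> M}, forall k (x : X k), w (dsum_in x) = e k x.
Proof.
have supp (z : dsum X) : exists n, forall k, (n <= k)%N -> val z k = 0.
  by have /asboolP := valP z.
pose n z := sval (cid (supp z)).
pose w z := \sum_(k < n z) e k (val z k).
have nP z k : (n z <= k)%N -> val z k = 0 by rewrite /n; case: cid k.
have wE z m : (forall k, (m <= k)%N -> val z k = 0) ->
    w z = \sum_(k < m) e k (val z k).
  have extend p q : (p <= q)%N -> (forall k, (p <= k)%N -> val z k = 0) ->
      \sum_(k < q) e k (val z k) = \sum_(k < p) e k (val z k).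
    move=> /subnKC <- z0; rewrite big_split_ord /= [X in _ + X]big1 ?addr0 //.
    by move=> k _; rewrite z0 ?linear0 ?leq_addr.
  move=> mP; rewrite /w; have [le|/ltnW le] := leqP (n z) m.
    by rewrite (extend _ _ le (nP z)).
  by rewrite (extend _ _ le mP).
have [v vE] : exists v : {linear dsum X -> M}, v =1 w.
  apply: linear_exists => a y z; pose m := maxn (n y) (n z).
  have ym k : (m <= k)%N -> val y k = 0.
    by rewrite geq_max => /andP[/nP].
  have zm k : (m <= k)%N -> val z k = 0.
    by rewrite geq_max => /andP[_ /nP].
  rewrite (wE y m) // (wE z m) // (wE _ m) => [|k km].
    rewrite scaler_sumr -big_split /=; apply: eq_bigr => k _.
    by rewrite -linearP.
  by rewrite -[LHS]/(a *: val y k + val z k) ym // zm // scaler0 addr0.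
exists v => k x; rewrite vE (wE _ k.+1) => [|j kj]; last first.
  by rewrite /= dfwith_out // neq_ltn kj.
rewrite big_ord_recr /= dfwith_in big1 ?add0r // => j _.
by rewrite dfwith_out ?linear0 // neq_ltn ltn_ord orbT.
Qed.

End DirectSum.

(** * Torsion of a reduced module *)

Section Torsion.
Variables (R : comPzRingType) (I : ideal R) (M : lmodType R).

Lemma quotm_gen (J : ideal R) (f : homm (quotm J) M) (a : R) :
  f (piq J a) = a *: f (piq J (1 : R)).
Proof.
rewrite -linearZ -[a *: piq J _]linearZ /=.
by rewrite -[a *: (1 : R^o)]/(a * 1) mulr1.
Qed.

Lemma homm_quotm_eq (J : ideal R) (f g : homm (quotm J) M) :
  f (piq J (1 : R)) = g (piq J (1 : R)) -> f = g.
Proof.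
move=> fg; apply: homP => q; case: (piq_surj q) => a ->.
by rewrite quotm_gen fg -quotm_gen.
Qed.

Lemma homm_quotm_ann (J : ideal R) (f : homm (quotm J) M) :
  f (piq J (1 : R)) \in annm M (idealset J).
Proof.
apply/annmP => a aJ; rewrite -quotm_gen.
have -> : piq J a = piq J 0 by apply/eq_piq; rewrite subr0.
by rewrite !linear0.
Qed.

Lemma homm_quotm_ex (J : ideal R) (x : M) : x \in annm M (idealset J) ->
  exists f : homm (quotm J) M, f (piq J (1 : R)) = x.
Proof.
move=> /annmP xJ.
have reprE (a : R) : (repr (piq J a) : R) *: x = a *: x.
  apply/eqP; rewrite -subr_eq0 -scalerBl; apply/eqP/xJ.
  by apply/eq_piq; rewrite /piq reprK.
have [f fE] : exists f : {linear quotm J -> M},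
    f =1 (fun q => (repr q : R) *: x).
  apply: linear_exists => a q r; case: (piq_surj q) (piq_surj r) => b -> [c ->].
  by rewrite -linearP !reprE scalerDl scalerA.
by exists f; rewrite fE reprE scale1r.
Qed.

Hypothesis M_reduced : reduced I M.

(** The torsion and T are both quotients of the direct sum of the Hom(R/I^k, M),
    the second one by evaluation at 1.  The kernels agree because, modulo the
    relations K defining the colimit, every element of the direct sum comes from
    the summand of index 1, where evaluation at 1 is injective. *)
Lemma torsion_reduced : isomorphic (torsion I M) (submod (annm M (idealset I))).
Proof.
set T := annm M (idealset I).
pose X k : lmodType R := homm (quotm (ideal_exp I k)) M.
pose t i j (le_ij : (i <= j)%N) : {linear X i -> X j} :=
  precomp M (quotm_proj (ideal_expS (I := I) le_ij)).
pose K := spanm [set z : dsum X | exists i j (le_ij : (i <= j)%N) (x : X i),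
    z = dsum_in x - dsum_in (t i j le_ij x)]%classic.
pose one k := piq (ideal_exp I k) (1 : R).
have homT k (f : X k) : f (one k) \in T.
  exact: (reduced_ideal_exp M_reduced (homm_quotm_ann f)).
have [e eE] : exists e : forall k, {linear X k -> submod T},
    forall k (f : X k), val (e k f) = f (one k).
  have ex k : exists e : {linear X k -> submod T},
      forall f : X k, val (e f) = f (one k).
    have [|e eE] := @linear_exists _ (X k) (submod T)
      (fun f => exist (fun x => x \in T) _ (homT k f)).
      by move=> a f g; apply: val_inj.
    by exists e => f; rewrite eE.
  by exists (fun k => sval (cid (ex k))) => k; case: cid.
have [w wE] := dsum_desc e.
have expT : {subset T <= annm M (idealset (ideal_exp I 1))}.
  by move=> x /annmP xT; apply/annmP => a aI; apply/xT/(ideal_exp1_sub aI).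
have w_surj x : exists f : X 1%N, w (dsum_in f) = x.
  have [f fE] := homm_quotm_ex (expT _ (valP x)).
  by exists f; rewrite wE; apply: val_inj; rewrite eE.
have wK z : z \in K -> w z = 0.
  move=> zK; apply/eqP; suff : z \in kerm w by [].
  move: z zK; apply: span_sub => _ [i [j [le_ij [f ->]]]].
  rewrite unfold_in /= /ker_pred linearB subr_eq0 !wE; apply/eqP/val_inj.
  by rewrite !eE /= quotm_projE.
have normal z : exists f : X 1%N, z - dsum_in f \in K.
  elim/dsum_ind: z => [|y z [f yf] [g zg]|k f].
  - by exists 0; rewrite linear0 subr0; apply: rpred0.
  - by exists (f + g); rewrite linearD opprD addrACA; apply: rpredD.
  have [g gE] := homm_quotm_ex (expT _ (homT k f)); exists g.
  (* I^0 = R, so f = 0 in index 0; in the other indices f is the image of g under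
     the transition map *)
  case: k f gE => [|k] f gE.
    have f0 : f (one 0%N) = 0.
      by rewrite -[LHS]scale1r; apply: (elimT (annmP _ _) (homm_quotm_ann f)).
    have -> : f = 0 by apply: homm_quotm_eq.
    have -> : g = 0 by apply: homm_quotm_eq; rewrite gE.
    by rewrite !linear0 addr0; apply: rpred0.
  have -> : f = t 1%N k.+1 isT g.
    by apply: homm_quotm_eq; rewrite /= quotm_projE gE.
  rewrite -opprB -scaleN1r; apply: rpredZ.
  by apply: mem_span; exists 1%N, k.+1, isT, g.
apply: (@isomorphic_coimages _ (dsum X) (quotm K) (submod T) (piq K) w).
- by move=> q; case: (piq_surj q) => z ->; exists z.
- by move=> x; have [f <-] := w_surj x; exists (dsum_in f).
move=> z; rewrite -[in X in X <-> _](linear0 (piq K)) eq_piq subr0.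
split=> [/wK // | wz0].
have [f zf] := normal z.
have f0 : f = 0.
  apply: homm_quotm_eq; rewrite -eE -wE.
  by rewrite -[dsum_in f](subKr z) linearB wz0 (wK _ zf) subr0.
by move: zf; rewrite f0 linear0 subr0.
Qed.

End Torsion.

Lemma completion_homm_torsion (R : comPzRingType) (I : ideal R)
    (M N : lmodType R) :
  fin_gen I -> reduced I M -> injective_module N ->
  isomorphic (completion I (homm M N)) (homm (torsion I M) N).
Proof.
move=> I_fg M_red N_inj.
apply: isomorphic_trans (completion_homm I_fg M_red N_inj) _.
by apply: isomorphic_homm; apply: isomorphic_sym; apply: torsion_reduced.
Qed.

Theorem proposition5p3 (R : comPzRingType) (I : ideal R) (M N : lmodType R)
    (I_fin_gen : fin_gen I) (M_reduced : reduced I M)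
    (N_injective : injective_module N) :
  isomorphic (completion I (homm M N)) (homm (torsion I M) N) /\
  forall (E : max_ideal R -> lmodType R)
    (e : forall m : max_ideal R, {linear quotm m -> E m})
    (E_hull : forall m : max_ideal R, injective_hull (e m)),
    isomorphic (completion I (matlis_dual E M)) (matlis_dual E (torsion I M)).
Proof.
split=> [|E e E_hull]; first exact: completion_homm_torsion.
apply: completion_homm_torsion => //; apply: injective_prodm => m.
by case: (E_hull m).
Qed.
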